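(* Any two regular P-configurations are conjugate. More precisely: if $(I,\delta_1,\delta_2)$ and $(I,\sigma_1,\sigma_2)$ are two regular P-configurations in $I=[-1,1]$, then there exists a unique homeomorphism $h:I\to I$ such that $$h(-1)=-1,\quad h(0)=0,\quad h(1)=1$$ and $$h(\delta_i(t))=\sigma_i(h(t)),\qquad i=1,2,\ t\in I.$$
   Context: Let $I=[-1,1]$. Two $C^1$ maps $\delta_1,\delta_2:I\to I$ form a P-configuration in $I$ if $\delta_1(t)+\delta_2(t)=t$ for all $t\in I$; $\delta_i'(t)\ge 0$ for all $t\in I$, $i=1,2$; and $\delta_2(-1)=-1$, $\delta_2(1)=\delta_1(-1)=0$, $\delta_1(1)=1$. The P-configuration is called regular if both guiding sets $\Lambda_i=\{t\in I:\delta_i'(t)=0\}$, $i=1,2$, are empty, i.e. $\delta_1'(t)>0$ and $\delta_2'(t)>0$ for all $t\in I$; it is then denoted $(I,\delta_1,\delta_2)$. Two regular P-configurations $(I,\delta_1,\delta_2)$ and $(I,\sigma_1,\sigma_2)$ are conjugate if there is a homeomorphism $h:I\to I$ with $h(\delta_i(t))=\sigma_i(h(t))$ for $i=1,2$ and all $t\in I$. *)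

(* Defs.v *)
From mathcomp Require Import all_boot all_order all_algebra.
From mathcomp Require Import all_classical all_reals all_analysis.
Set Implicit Arguments.
Unset Strict Implicit.
Unset Printing Implicit Defensive.
Import Order.TTheory GRing.Theory Num.Theory.
Import numFieldNormedType.Exports.
Local Open Scope classical_set_scope.
Local Open Scope ring_scope.

(* The coercion [set_type] turns [Iset R] into the space I = [-1, 1] with the
   topology induced from R; maps I -> I are functions [Iset R -> Iset R]. *)
Definition Iset (R : realType) : set R := `[-1, 1].
Arguments Iset : clear implicits.

Lemma Iset_N1 (R : realType) : (-1 : R) \in Iset R.
Proof. by rewrite inE /Iset /= in_itv /= lexx (le_trans (lerN10 R) ler01). Qed.

Lemma Iset_0 (R : realType) : (0 : R) \in Iset R.
Proof. by rewrite inE /Iset /= in_itv /= oppr_le0 ler01. Qed.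

Lemma Iset_1 (R : realType) : (1 : R) \in Iset R.
Proof. by rewrite inE /Iset /= in_itv /= lexx (le_trans (lerN10 R) ler01). Qed.

Definition ptN1 (R : realType) : Iset R := exist _ (-1) (Iset_N1 R).
Definition pt0 (R : realType) : Iset R := exist _ 0 (Iset_0 R).
Definition pt1 (R : realType) : Iset R := exist _ 1 (Iset_1 R).
Arguments ptN1 : clear implicits.
Arguments pt0 : clear implicits.
Arguments pt1 : clear implicits.

Section PConfiguration.
Context {R : realType}.
Local Notation I := (Iset R).
Implicit Types (f h delta sigma : I -> I) (t x : I).

Definition diff_quot f t x : R := (\val (f x) - \val (f t)) / (\val x - \val t).

(* [t^'] is the filter of punctured neighbourhoods of t in I, so that the
   derivative is one-sided at the end points. *)
Definition derivableI f t : Prop := cvg (diff_quot f t @ t^').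
Definition deriveI f t : R := lim (diff_quot f t @ t^').

Definition C1 f : Prop := (forall t, derivableI f t) /\ continuous (deriveI f).

Record p_configuration delta1 delta2 : Prop := PConfiguration {
  pconf_C1_1 : C1 delta1;
  pconf_C1_2 : C1 delta2;
  pconf_sum : forall t, \val (delta1 t) + \val (delta2 t) = \val t;
  pconf_deriv1_ge0 : forall t, 0 <= deriveI delta1 t;
  pconf_deriv2_ge0 : forall t, 0 <= deriveI delta2 t;
  pconf_2_N1 : delta2 (ptN1 R) = ptN1 R;
  pconf_2_1 : delta2 (pt1 R) = pt0 R;
  pconf_1_N1 : delta1 (ptN1 R) = pt0 R;
  pconf_1_1 : delta1 (pt1 R) = pt1 R }.

Definition guiding_set f : set I := [set t | deriveI f t = 0].

Definition regular_p_configuration delta1 delta2 : Prop :=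
  [/\ p_configuration delta1 delta2,
      guiding_set delta1 = set0 & guiding_set delta2 = set0].

Definition homeomorphism h : Prop :=
  continuous h /\ exists g : I -> I, [/\ continuous g, cancel h g & cancel g h].

Definition conjugates h delta1 delta2 sigma1 sigma2 : Prop :=
  (forall t, h (delta1 t) = sigma1 (h t)) /\
  (forall t, h (delta2 t) = sigma2 (h t)).

Definition conjugate delta1 delta2 sigma1 sigma2 : Prop :=
  exists h, homeomorphism h /\ conjugates h delta1 delta2 sigma1 sigma2.

End PConfiguration.

(* Main.v *)
Require Import Defs.
From mathcomp Require Import all_boot all_order all_algebra.
From mathcomp Require Import all_classical all_reals all_analysis.
From mathcomp Require Import lra.
Set Implicit Arguments.
Unset Strict Implicit.
Unset Printing Implicit Defensive.
Import Order.TTheory GRing.Theory Num.Theory.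
Import numFieldNormedType.Exports.
Local Open Scope classical_set_scope.
Local Open Scope ring_scope.

(** The derivatives of a regular pair are continuous and positive on a compact
    interval, hence bounded below by some [m > 0]; as they add up to [1], both
    maps have all their slopes between [m] and [1 - m].  So [delta1] and
    [delta2] are strictly increasing contractions, and their images [[0, 1]]
    and [[-1, 0]] cover [I] and meet only at [0 = delta1 (-1) = delta2 1]
    ([regular_slope_pair], [sp_surj1], [sp_surj2]).  This
    exhibits [I] as the attractor of a two-map iterated function system: every
    point is coded by an infinite binary word, and the conjugacy sends a point
    to the point of the other system with the same code.

    The codes themselves stay implicit.  The two conjugacy equations say that
    [h] is a fixed point of the operator that, on each half of [I], replaces [u]
    by [sigma_i \o u \o delta_i^-1].  This operator is order preserving and keeps
    nondecreasing maps nondecreasing, so a nondecreasing fixed point exists by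
    the Knaster-Tarski argument ([nondecr_fixpoint], [conjugates_exists]).  It
    also contracts the supremum distance, because [sigma1] and [sigma2] contract,
    so two maps, continuous or not, that satisfy the equations coincide
    ([conjugates_unique]).

    Exchanging the roles of the two pairs gives a map in the other direction;
    both composites commute with one of the pairs, as the identity does, and
    are therefore the identity.  The conjugacy is thus a nondecreasing
    bijection of [I], which makes it and its inverse continuous
    ([nondecr_bij_continuous]). *)

(** * The interval as a subspace of the line *)

Section Interval.
Context {R : realType}.
Local Notation I := (Iset R).
Implicit Types (f : I -> I) (x y t : I) (r : R).

Lemma val_itv x : -1 <= \val x <= 1.
Proof. by case: x => r /= /set_mem; rewrite /Iset /= in_itv. Qed.

Fact clamp_subproof r : Num.max (-1) (Num.min r 1) \in Iset R.
Proof.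
rewrite inE /Iset /= in_itv /= le_max lexx /= ge_max ge_min lexx orbT andbT.
by rewrite (le_trans (lerN10 R) ler01).
Qed.

Definition clamp r : I := exist (fun s => s \in Iset R) _ (clamp_subproof r).

Lemma val_clamp r : -1 <= r <= 1 -> \val (clamp r) = r.
Proof. by move=> /andP[r1 r2] /=; rewrite min_l// max_r. Qed.

Lemma clamp_val x : clamp (\val x) = x.
Proof. by apply: val_inj; apply: val_clamp; exact: val_itv. Qed.

(** Extending a map on [I] by [clamp] makes the intermediate value, extreme
    value and mean value theorems for functions on [R] applicable to it. *)
Lemma within_clamp (Y : topologicalType) (g : I -> Y) :
  {within `[-1, 1], continuous (g \o clamp)} <-> continuous g.
Proof.
have -> : g = sigL (Iset R) (g \o clamp).
  by apply/funext => x; rewrite /sigL /= [set_val x]/(\val x) clamp_val.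
have -> : sigL (Iset R) (g \o clamp) \o clamp = g \o clamp.
  by apply/funext => r; rewrite /sigL /= [set_val _]/(\val (clamp r)) clamp_val.
exact: subspace_sigL_continuousP.
Qed.

Lemma continuous_val f : continuous (fun x => \val (f x)) -> continuous f.
Proof.
by move=> /continuousP cf; apply/continuousP => _ [B oB <-]; exact: cf.
Qed.

Lemma nbhs_val t (P : set I) : nbhs t P <->
  exists2 e : R, 0 < e & forall x, `|\val t - \val x| < e -> P x.
Proof.
split=> [/nbhs_ballP[e e0 eP]|[e e0 eP]]; first by exists e.
by apply/nbhs_ballP; exists e => // x; exact: eP.
Qed.

(** * From positive derivatives to bounded slopes *)

Lemma derivableI_dist f t (e : R) : derivableI f t -> 0 < e ->
  exists2 d : R, 0 < d & forall x, `|\val t - \val x| < d -> x != t ->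
    `|deriveI f t - diff_quot f t x| < e.
Proof.
by move=> df e0; apply/nbhs_val; move/cvgrPdist_lt : df; apply.
Qed.

Lemma derivableI_continuous f :
  (forall t, derivableI f t) -> continuous (fun x => \val (f x)).
Proof.
move=> df t; apply/(cvgrPdist_lt (FF := nbhs_filter t)) => e e0.
have [d d0 dP] := derivableI_dist (df t) ltr01.
(* Near [t] the difference quotients are within 1 of their limit. *)
set M := `|deriveI f t| + 1.
have M0 : 0 < M by rewrite ltr_wpDl.
apply/nbhs_val; exists (Num.min d (e / M)) => [|x].
  by rewrite lt_min d0 divr_gt0.
rewrite lt_min => /andP[xd xe].
have [->|xt] := eqVneq x t; first by rewrite subrr normr0.
have vxt : \val x - \val t != 0 by rewrite subr_eq0 (inj_eq val_inj).
have qM : `|diff_quot f t x| <= M.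
  have := ler_normB (deriveI f t) (deriveI f t - diff_quot f t x).
  by rewrite subKr => /le_trans; apply; rewrite lerD2l; exact/ltW/dP.
have -> : \val (f t) - \val (f x) = diff_quot f t x * (\val t - \val x).
  by rewrite /diff_quot -[\val t - _]opprB mulrN divfK// opprB.
have M0e : M * `|\val t - \val x| < e by rewrite mulrC -ltr_pdivlMr.
by rewrite normrM (le_lt_trans _ M0e)// ler_wpM2r.
Qed.

(** The minimum with [r + 1] and [1 - r] keeps the increment inside [I], where
    [clamp] is the identity; this is where [r] must be an interior point. *)
Lemma is_derive_clamp f r : derivableI f (clamp r) -> r \in `]-1, 1[ ->
  is_derive r (1 : R) (fun s => \val (f (clamp s))) (deriveI f (clamp r)).
Proof.
rewrite in_itv /= => df /andP[r1 r2].
set F := fun s => \val (f (clamp s)).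
suff cF : (fun k : R => k^-1 *: ((F \o shift r) (k *: (1 : R)) - F r)) @ 0^'
    --> deriveI f (clamp r).
  by split; [exact: cvgP cF|exact: cvg_lim cF].
apply/cvgrPdist_lt => e e0.
have [d d0 dP] := derivableI_dist df e0.
have vr : \val (clamp r) = r by apply: val_clamp; rewrite !ltW.
near=> k.
have h0 : k != 0 by near: k; exact: nbhs_dnbhs_neq.
have : `|k| < Num.min d (Num.min (r + 1) (1 - r)).
  near: k; apply: (@dnbhs0_lt R R^o).
  by rewrite !lt_min d0 /=; apply/andP; split; lra.
rewrite !lt_min => /and3P[hd /ltr_normlP[h1 _] /ltr_normlP[_ h2]].
have vh : \val (clamp (k + r)) = k + r by apply: val_clamp; lra.
have hx : clamp (k + r) != clamp r.
  by rewrite -(inj_eq val_inj) vh vr -subr_eq0 addrK.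
have hd' : `|\val (clamp r) - \val (clamp (k + r))| < d.
  by rewrite vh vr distrC addrK.
have := dP _ hd' hx.
by rewrite /diff_quot vh vr addrK /F /= /GRing.scale /= mulr1 mulrC.
Unshelve. all: by end_near. Qed.

Definition slope_ge (m : R) (f : I -> I) : Prop := forall x y,
  \val x <= \val y -> m * (\val y - \val x) <= \val (f y) - \val (f x).

(** Compactness of [I] makes the positivity of the derivative uniform, and the
    mean value theorem carries the bound over to the slopes. *)
Lemma C1_slope_lower_bound f : C1 f -> (forall t, 0 < deriveI f t) ->
  exists2 m : R, 0 < m & slope_ge m f.
Proof.
move=> [df cdf] df0.
have N11 : (-1 : R) <= 1 by rewrite (le_trans (lerN10 R)).
have [c _ cmin] := EVT_min N11 ((within_clamp _).2 cdf).
exists (deriveI f (clamp c)) => // x y xy.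
have [/andP[x1 _] /andP[_ y1]] := (val_itv x, val_itv y).
have dF r : r \in `](\val x), (\val y)[ -> is_derive r (1 : R)
    (fun s => \val (f (clamp s))) (deriveI f (clamp r)).
  rewrite in_itv /= => /andP[xr ry]; apply: is_derive_clamp => //.
  by rewrite in_itv /= (le_lt_trans x1)// (lt_le_trans ry).
have cF : {within `[\val x, \val y], continuous (fun s => \val (f (clamp s)))}.
  have /within_clamp := derivableI_continuous df.
  by apply: continuous_subspaceW; apply: subset_itv; rewrite bnd_simp.
have [r rxy] := MVT_segment xy dF cF.
rewrite !clamp_val => ->.
rewrite ler_wpM2r ?subr_ge0//; apply: cmin; move: rxy.
by rewrite !in_itv /= => /andP[xr ry]; rewrite (le_trans x1)// (le_trans ry).
Qed.

Lemma guiding_set0_gt0 f : (forall t, 0 <= deriveI f t) ->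
  guiding_set f = set0 -> forall t, 0 < deriveI f t.
Proof.
move=> f0 gf t; rewrite lt0r f0 andbT; apply/eqP => ft.
by have : guiding_set f t by []; rewrite gf.
Qed.

End Interval.

Section SlopePair.
Context {R : realType}.
Local Notation I := (Iset R).
Implicit Types (x y t : I).

Lemma slope_ge_weaken (m m' : R) (f : I -> I) :
  m' <= m -> slope_ge m f -> slope_ge m' f.
Proof.
move=> mm' fm x y xy; apply: le_trans (fm _ _ xy).
by rewrite ler_wpM2r ?subr_ge0.
Qed.

Section Slope.
Variables (m : R) (f g : I -> I).
Hypotheses (m0 : 0 < m) (fm : slope_ge m f).

Lemma slope_ge_mono x y : (\val (f x) <= \val (f y)) = (\val x <= \val y).
Proof.
apply/idP/idP => [|xy]; last first.
  by rewrite -subr_ge0 (le_trans _ (fm xy))// mulr_ge0 ?subr_ge0// ltW.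
apply: contraTT; rewrite -!ltNge => yx; rewrite -subr_gt0.
by apply: lt_le_trans (fm (ltW yx)); rewrite mulr_gt0// subr_gt0.
Qed.

Lemma slope_ge_inj : injective f.
Proof.
move=> x y xy; apply/val_inj/le_anti.
by rewrite -(slope_ge_mono x y) -(slope_ge_mono y x) xy lexx.
Qed.

Hypotheses (gm : slope_ge m g) (fg : forall t, \val (f t) + \val (g t) = \val t).

(** A lower bound on the slopes of one summand of the identity is an upper bound
    on the slopes of the other. *)
Lemma slope_ge_contract x y :
  `|\val (f x) - \val (f y)| <= (1 - m) * `|\val x - \val y|.
Proof.
wlog xy : x y / \val x <= \val y => [th|].
  have [/th //|/ltW/th] := leP (\val x) (\val y).
  by rewrite distrC (distrC (\val y)).
have := gm xy; have := fg x; have := fg y.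
rewrite !ler0_norm ?subr_le0 ?slope_ge_mono//; lra.
Qed.

Lemma slope_ge_continuous : continuous (fun x => \val (f x)).
Proof.
move=> x; apply/(cvgrPdist_lt (FF := nbhs_filter x)) => e e0.
apply/nbhs_val; exists e => // y; apply: le_lt_trans.
apply: le_trans (slope_ge_contract _ _) _.
by rewrite ler_piMl// lerBlDr lerDl ltW.
Qed.

Lemma slope_ge_IVT r : \val (f (ptN1 R)) <= r <= \val (f (pt1 R)) ->
  exists t, \val (f t) = r.
Proof.
move=> /andP[r1 r2].
have N11 : (-1 : R) <= 1 by rewrite (le_trans (lerN10 R)).
have [|s _ <-] := IVT (v := r) N11 ((within_clamp _).2 slope_ge_continuous).
  rewrite /comp.
  have -> : clamp (-1 : R) = ptN1 R by exact: (clamp_val (ptN1 R)).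
  have -> : clamp (1 : R) = pt1 R by exact: (clamp_val (pt1 R)).
  by rewrite ge_min r1 le_max r2 orbT.
by exists (clamp s).
Qed.

End Slope.

(** * Pairs of contractions covering the interval *)

(** Slopes bounded below stand in for positive derivatives: they make both maps
    injective and, as the maps add up to the identity, contracting. *)
Record slope_pair (m : R) (d1 d2 : I -> I) : Prop := SlopePair {
  sp_gt0 : 0 < m;
  sp_slope1 : slope_ge m d1;
  sp_slope2 : slope_ge m d2;
  sp_sum : forall t, \val (d1 t) + \val (d2 t) = \val t;
  sp_2N1 : d2 (ptN1 R) = ptN1 R;
  sp_21 : d2 (pt1 R) = pt0 R;
  sp_1N1 : d1 (ptN1 R) = pt0 R;
  sp_11 : d1 (pt1 R) = pt1 R }.

Lemma regular_slope_pair d1 d2 :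
  regular_p_configuration d1 d2 -> exists m, slope_pair m d1 d2.
Proof.
move=> [[C1d1 C1d2 sum d1_ge0 d2_ge0 b1 b2 b3 b4] L1 L2].
have [m1 m1_gt0 s1] := C1_slope_lower_bound C1d1 (guiding_set0_gt0 d1_ge0 L1).
have [m2 m2_gt0 s2] := C1_slope_lower_bound C1d2 (guiding_set0_gt0 d2_ge0 L2).
exists (Num.min m1 m2); split=> //; first by rewrite lt_min m1_gt0.
  by apply: slope_ge_weaken s1; rewrite ge_min lexx.
by apply: slope_ge_weaken s2; rewrite ge_min lexx orbT.
Qed.

Section CoveringContractions.
Variables (m : R) (d1 d2 : I -> I).
Hypothesis dP : slope_pair m d1 d2.
Let m0 := sp_gt0 dP.
Let mono1 := slope_ge_mono m0 (sp_slope1 dP).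
Let mono2 := slope_ge_mono m0 (sp_slope2 dP).
Let sumC t : \val (d2 t) + \val (d1 t) = \val t.
Proof. by rewrite addrC (sp_sum dP). Qed.

Lemma sp_ge0 t : 0 <= \val (d1 t).
Proof.
rewrite -[0]/(\val (pt0 R)) -(sp_1N1 dP) mono1.
by have /andP[] := val_itv t.
Qed.

Lemma sp_le0 t : \val (d2 t) <= 0.
Proof.
rewrite -[0]/(\val (pt0 R)) -(sp_21 dP) mono2.
by have /andP[] := val_itv t.
Qed.

Lemma sp_contract1 x y :
  `|\val (d1 x) - \val (d1 y)| <= (1 - m) * `|\val x - \val y|.
Proof.
exact: slope_ge_contract m0 (sp_slope1 dP) (sp_slope2 dP) (sp_sum dP) _ _.
Qed.

Lemma sp_contract2 x y :
  `|\val (d2 x) - \val (d2 y)| <= (1 - m) * `|\val x - \val y|.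
Proof. exact: slope_ge_contract m0 (sp_slope2 dP) (sp_slope1 dP) sumC _ _. Qed.

Lemma sp_surj1 x : 0 <= \val x -> exists t, d1 t = x.
Proof.
move=> x0; have [|t tx] := slope_ge_IVT m0 (sp_slope1 dP) (sp_slope2 dP)
    (sp_sum dP) (r := \val x); last by exists t; exact: val_inj.
by rewrite (sp_1N1 dP) (sp_11 dP) /= x0; have /andP[] := val_itv x.
Qed.

Lemma sp_surj2 x : \val x <= 0 -> exists t, d2 t = x.
Proof.
move=> x0; have [|t tx] := slope_ge_IVT m0 (sp_slope2 dP) (sp_slope1 dP)
    sumC (r := \val x); last by exists t; exact: val_inj.
by rewrite (sp_2N1 dP) (sp_21 dP) /= x0 andbT; have /andP[] := val_itv x.
Qed.

Lemma sp_cover x : (exists t, x = d1 t) \/ (exists t, x = d2 t).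
Proof.
have [/sp_surj1|/ltW/sp_surj2] := leP 0 (\val x) => -[t <-].
  by left; exists t.
by right; exists t.
Qed.

Lemma sp_fix1 x : d1 x = x -> x = pt1 R.
Proof.
move=> x1; apply/val_inj/eqP; rewrite -subr_eq0 -normr_le0.
have := sp_contract1 x (pt1 R); rewrite x1 (sp_11 dP).
have := normr_ge0 (\val x - \val (pt1 R)).
by have := m0; nra.
Qed.

Lemma sp_fix2 x : d2 x = x -> x = ptN1 R.
Proof.
move=> x1; apply/val_inj/eqP; rewrite -subr_eq0 -normr_le0.
have := sp_contract2 x (ptN1 R); rewrite x1 (sp_2N1 dP).
have := normr_ge0 (\val x - \val (ptN1 R)).
by have := m0; nra.
Qed.

End CoveringContractions.

(** * Uniqueness of the conjugacy *)

(** Two maps intertwining the same pairs can be compared at [x] by first writing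
    [x] as [d1 t] or [d2 t]: their distance at [x] is at most [1 - m'] times
    their distance at [t], so its supremum is zero. *)
Lemma conjugates_unique m m' (d1 d2 s1 s2 h k : I -> I) :
  slope_pair m d1 d2 -> slope_pair m' s1 s2 ->
  conjugates h d1 d2 s1 s2 -> conjugates k d1 d2 s1 s2 -> h = k.
Proof.
move=> dP sP [h1 h2] [k1 k2].
pose A : set R := range (fun x => `|\val (h x) - \val (k x)|).
have supA : has_sup A.
  split; first by exists `|\val (h (pt0 R)) - \val (k (pt0 R))|, (pt0 R).
  exists 2 => _ [x _ <-].
  have /andP[? ?] := val_itv (h x); have /andP[? ?] := val_itv (k x).
  by rewrite ler_norml; apply/andP; split; lra.
have leA x : `|\val (h x) - \val (k x)| <= sup A.
  by apply: sup_upper_bound => //; exists x.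
have A0 := le_trans (normr_ge0 _) (leA (pt0 R)).
have m1 : m' <= 1.
  have := sp_slope1 sP (x := ptN1 R) (y := pt1 R).
  by rewrite (sp_11 sP) (sp_1N1 sP) /=; lra.
have subA : sup A <= (1 - m') * sup A.
  apply: ge_sup; first by case: supA.
  move=> _ [x _ <-]; case: (sp_cover dP x) => -[t ->].
    rewrite h1 k1 (le_trans (sp_contract1 sP _ _))//.
    by rewrite ler_wpM2l// subr_ge0.
  rewrite h2 k2 (le_trans (sp_contract2 sP _ _))//.
  by rewrite ler_wpM2l// subr_ge0.
have {}subA : sup A <= 0 by have := sp_gt0 sP; nra.
apply/funext => x; apply/val_inj/eqP.
by rewrite -subr_eq0 -normr_le0 (le_trans (leA x)).
Qed.

(** * Existence of the conjugacy *)

Definition nondecr (u : I -> I) : Prop :=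
  forall x y, \val x <= \val y -> \val (u x) <= \val (u y).

(** Knaster-Tarski: a pointwise supremum of nondecreasing maps is
    nondecreasing, so the supremum of the maps lying below their image under a
    monotone operator is a fixed point. *)
Lemma nondecr_fixpoint (Phi : (I -> I) -> (I -> I)) :
  (forall u, nondecr u -> nondecr (Phi u)) ->
  (forall u v, (forall x, \val (u x) <= \val (v x)) ->
    forall x, \val (Phi u x) <= \val (Phi v x)) ->
  exists2 h, nondecr h & Phi h = h.
Proof.
move=> Phi_nd Phi_mono.
pose S : set (I -> I) :=
  [set u | nondecr u /\ forall x, \val (u x) <= \val (Phi u x)].
pose V x : set R := (fun u : I -> I => \val (u x)) @` S.
pose h x : I := clamp (sup (V x)).
have supV x : has_sup (V x).
  split; last first.
    by exists 1 => _ [u _ <-]; have /andP[] := val_itv (u x).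
  exists (-1), (fun=> ptN1 R) => //; split=> // y.
  by have /andP[] := val_itv (Phi (fun=> ptN1 R) y).
have val_h x : \val (h x) = sup (V x).
  apply: val_clamp; apply/andP; split.
    apply: sup_upper_bound => //; exists (fun=> ptN1 R) => //; split=> // y.
    by have /andP[] := val_itv (Phi (fun=> ptN1 R) y).
  apply: ge_sup; first by case: (supV x).
  by move=> _ [u _ <-]; have /andP[] := val_itv (u x).
have S_le u x : S u -> \val (u x) <= \val (h x).
  by move=> Su; rewrite val_h; apply: sup_upper_bound => //; exists u.
have h_le x r : (forall u, S u -> \val (u x) <= r) -> \val (h x) <= r.
  move=> ur; rewrite val_h; apply: ge_sup; first by case: (supV x).
  by move=> _ [u Su <-]; exact: ur.
have h_nd : nondecr h.
  move=> x y xy; apply: h_le => u Su; apply: le_trans (S_le _ _ Su).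
  by case: Su => u_nd _; exact: u_nd.
have h_Phi x : \val (h x) <= \val (Phi h x).
  apply: h_le => u Su; have [_ /(_ x)/le_trans] := Su; apply.
  by apply: Phi_mono => y; exact: S_le.
exists h => //; apply/funext => x; apply/val_inj/le_anti.
by rewrite h_Phi andbT; apply: S_le; split; [exact: Phi_nd|exact: Phi_mono].
Qed.

(** The fixed-point equation reads [h (d2 t) = s2 (h t)] only for [d2 t < 0]; at
    the common value [0 = d2 1 = d1 (-1)] it speaks of [d1] alone.  The remaining
    equation [h 0 = s2 (h 1)] holds because [h] must send the fixed points [-1]
    of [d2] and [1] of [d1] to those of [s2] and [s1], so that both sides are
    [0]. *)
Lemma conjugates_exists m m' (d1 d2 s1 s2 : I -> I) :
  slope_pair m d1 d2 -> slope_pair m' s1 s2 ->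
  exists h, [/\ nondecr h, conjugates h d1 d2 s1 s2 &
    [/\ h (ptN1 R) = ptN1 R, h (pt0 R) = pt0 R & h (pt1 R) = pt1 R]].
Proof.
move=> dP sP.
have mono_d1 := slope_ge_mono (sp_gt0 dP) (sp_slope1 dP).
have mono_d2 := slope_ge_mono (sp_gt0 dP) (sp_slope2 dP).
have mono_s1 := slope_ge_mono (sp_gt0 sP) (sp_slope1 sP).
have mono_s2 := slope_ge_mono (sp_gt0 sP) (sp_slope2 sP).
have /choice[T1 T1K] : forall x, exists t, 0 <= \val x -> d1 t = x.
  move=> x; have [/(sp_surj1 dP)[t tx]|] := leP 0 (\val x); first by exists t.
  by exists x.
have /choice[T2 T2K] : forall x, exists t, \val x <= 0 -> d2 t = x.
  move=> x; have [/(sp_surj2 dP)[t tx]|] := leP (\val x) 0; first by exists t.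
  by exists x.
(* At 0, where both inverse branches are defined, the one of [d1] is used. *)
pose Phi (u : I -> I) x := if 0 <= \val x then s1 (u (T1 x)) else s2 (u (T2 x)).
have [u u_nd x y xy|u v uv x|h h_nd Phih] := @nondecr_fixpoint Phi.
- rewrite /Phi; have [x0|x0] := leP 0 (\val x).
    have y0 := le_trans x0 xy; rewrite y0 mono_s1; apply: u_nd.
    by rewrite -mono_d1 !T1K.
  (* Points on opposite sides of 0 have their images separated by 0. *)
  have [y0|y0] := leP 0 (\val y).
    exact: le_trans (sp_le0 sP _) (sp_ge0 sP _).
  by rewrite mono_s2; apply: u_nd; rewrite -mono_d2 !T2K// ltW.
- by rewrite /Phi; case: ifP => _; rewrite ?mono_s1 ?mono_s2.
have hpos x : 0 <= \val x -> h x = s1 (h (T1 x)).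
  by move=> x0; rewrite -[in LHS]Phih /Phi x0.
have hneg x : \val x < 0 -> h x = s2 (h (T2 x)).
  by move=> x0; rewrite -[in LHS]Phih /Phi leNgt x0.
have h1 t : h (d1 t) = s1 (h t).
  have d0 := sp_ge0 dP t; rewrite hpos//; congr (s1 (h _)).
  by apply: (slope_ge_inj (sp_gt0 dP) (sp_slope1 dP)); exact: T1K.
have h2' t : \val (d2 t) < 0 -> h (d2 t) = s2 (h t).
  move=> d0; rewrite hneg//; congr (s2 (h _)).
  by apply: (slope_ge_inj (sp_gt0 dP) (sp_slope2 dP)); exact/T2K/ltW.
have hN1 : h (ptN1 R) = ptN1 R.
  have := h2' (ptN1 R); rewrite (sp_2N1 dP) /= oppr_lt0 => /(_ ltr01) h2N.
  exact: (sp_fix2 sP).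
have h11 : h (pt1 R) = pt1 R.
  by apply: (sp_fix1 sP); rewrite -h1 (sp_11 dP).
have h00 : h (pt0 R) = pt0 R.
  by have := h1 (ptN1 R); rewrite (sp_1N1 dP) hN1 (sp_1N1 sP).
exists h; split=> //; split=> // t.
have [/h2' //|d0] := ltP (\val (d2 t)) 0.
have d2t : d2 t = d2 (pt1 R).
  by rewrite (sp_21 dP); apply/val_inj/le_anti; rewrite d0 (sp_le0 dP).
have -> : t = pt1 R by exact: slope_ge_inj (sp_gt0 dP) (sp_slope2 dP) _ _ d2t.
by rewrite (sp_21 dP) h00 h11 (sp_21 sP).
Qed.

(** * The conjugacy is a homeomorphism *)

(** A monotone surjection has no jumps. *)
Lemma nondecr_bij_continuous (h g : I -> I) :
  nondecr h -> cancel h g -> cancel g h -> continuous h.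
Proof.
move=> h_nd hK gK.
have h_mono x y : (\val (h x) <= \val (h y)) = (\val x <= \val y).
  apply/idP/idP => [hxy|]; last exact: h_nd.
  have [//|yx] := leP (\val x) (\val y).
  have xy : x = y.
    by apply/(can_inj hK)/val_inj/le_anti; rewrite hxy h_nd// ltW.
  by rewrite xy ltxx in yx.
apply/continuous_val/within_clamp/segment_inc_surj_continuous.
  by move=> r s; rewrite !in_itv /= => r1 s1; rewrite h_mono !val_clamp.
rewrite /comp => r rh.
have r1 : -1 <= r <= 1.
  move: rh; rewrite /= in_itv => /andP[ler ger].
  have /andP[h1 _] := val_itv (h (clamp (-1))).
  have /andP[_ h2] := val_itv (h (clamp 1)).
  by rewrite (le_trans h1)// (le_trans ger).
exists (\val (g (clamp r))); first by rewrite /= in_itv; exact: val_itv.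
by rewrite clamp_val gK val_clamp.
Qed.

(** The map back is itself an intertwining map, from [s1, s2] to [d1, d2], and
    by uniqueness the two composites are the identity. *)
Lemma conjugates_homeomorphism m m' (d1 d2 s1 s2 : I -> I) :
  slope_pair m d1 d2 -> slope_pair m' s1 s2 ->
  exists h, [/\ homeomorphism h, conjugates h d1 d2 s1 s2 &
    [/\ h (ptN1 R) = ptN1 R, h (pt0 R) = pt0 R & h (pt1 R) = pt1 R]].
Proof.
move=> dP sP.
have [h [h_nd hC h_pts]] := conjugates_exists dP sP.
have [g [g_nd gC _]] := conjugates_exists sP dP.
have compC (a b : I -> I) (p1 p2 q1 q2 r1 r2 : I -> I) :
    conjugates a p1 p2 q1 q2 -> conjugates b q1 q2 r1 r2 ->
    conjugates (b \o a) p1 p2 r1 r2.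
  by move=> [a1 a2] [b1 b2]; split=> t /=; rewrite ?a1 ?a2 ?b1 ?b2.
have gh : g \o h = id.
  by apply: (conjugates_unique dP dP (compC _ _ _ _ _ _ _ _ hC gC)).
have hg : h \o g = id.
  by apply: (conjugates_unique sP sP (compC _ _ _ _ _ _ _ _ gC hC)).
have hK : cancel h g by move=> x; rewrite -[RHS]/(id x) -gh.
have gK : cancel g h by move=> x; rewrite -[RHS]/(id x) -hg.
exists h; split=> //; split; first exact: nondecr_bij_continuous hK gK.
by exists g; split=> //; exact: nondecr_bij_continuous gK hK.
Qed.

End SlopePair.

Theorem proposition2p3 (R : realType)
    (delta1 delta2 sigma1 sigma2 : Iset R -> Iset R)
    (hdelta : regular_p_configuration delta1 delta2)
    (hsigma : regular_p_configuration sigma1 sigma2) :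
  conjugate delta1 delta2 sigma1 sigma2 /\
  exists! h : Iset R -> Iset R,
    homeomorphism h /\
    [/\ h (ptN1 R) = ptN1 R, h (pt0 R) = pt0 R & h (pt1 R) = pt1 R] /\
    conjugates h delta1 delta2 sigma1 sigma2.
Proof.
have [m dP] := regular_slope_pair hdelta.
have [m' sP] := regular_slope_pair hsigma.
have [h [h_homeo hC h_pts]] := conjugates_homeomorphism dP sP.
split; first by exists h.
exists h; split=> // k [_ [_ kC]].
exact: conjugates_unique dP sP hC kC.
Qed.
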